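(* Let $X$ be an ordered Banach space with cone $K$, let $\phi\in X'$, and define $$p_\phi(x)=\inf\{\langle y,\phi\rangle : y\in X,\ y\ge 0,\ y\ge x\},\qquad x\in X.$$ Let $A\colon X\supseteq\mathcal{D}(A)\to X$ be a $p_\phi$-dissipative operator. If $I-\lambda A$ is invertible for some $\lambda>0$, then $(I-\lambda A)^{-1}$ is $p_\phi$-contractive.
   Context: All vector spaces are real. A subset $K$ of a vector space $X$ is a cone if $\lambda x+\mu y\in K$ for all $x,y\in K$ and $\lambda,\mu\ge 0$, and $K\cap(-K)=\{0\}$. It induces the partial order $x\le y$ iff $y-x\in K$. An ordered Banach space is a Banach space $X$ equipped with the partial order induced by a cone $K$. $X'$ denotes the continuous linear functionals on $X$, $\langle x,\phi\rangle=\phi(x)$, and $K'$ denotes the set of positive functionals in $X'$, i.e. those $x'\in X'$ with $\langle x,x'\rangle\ge 0$ for all $x\in K$. Operators are linear, with domain $\mathcal{D}(A)$, a linear subspace of $X$. Invertibility of $I-\lambda A$ means that $I-\lambda A\colon\mathcal{D}(A)\to X$ is bijective with bounded inverse on $X$. For a function $p$ on $X$ and $x\in X$, the subdifferential is $$dp(x)=\{x'\in K' : \langle y,x'\rangle\le p(y)\text{ for all }y\in X,\ \langle x,x'\rangle=p(x)\}.$$ An operator $A\colon\mathcal{D}(A)\subseteq X\to X$ is $p$-dissipative if for every $x\in\mathcal{D}(A)$ there exists $y'\in dp(x)$ with $\langle Ax,y'\rangle\le 0$. A bounded operator $T$ on $X$ is $p$-contractive if $p(Tx)\le p(x)$ for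 all $x\in X$. *)

(* Defs.v *)
From HB Require Import structures.
From mathcomp Require Import all_boot all_order all_algebra.
From mathcomp Require Import all_classical all_reals all_analysis.

Set Implicit Arguments.
Unset Strict Implicit.
Unset Printing Implicit Defensive.

Import Order.TTheory GRing.Theory Num.Theory.
Import numFieldNormedType.Exports.

Local Open Scope classical_set_scope.
Local Open Scope ring_scope.

Section OrderedBanach.
Context {R : realType} {X : completeNormedModType R}.

(** Proper convex cone; [K] is not assumed closed, normal or generating. *)
Definition cone (K : set X) : Prop :=
  (forall (x y : X) (l m : R),
     K x -> K y -> 0 <= l -> 0 <= m -> K (l *: x + m *: y)) /\
  K `&` [set x | K (- x)] = [set 0].

Definition cone_le (K : set X) (x y : X) : Prop := K (y - x).

(** X' *)
Definition dual : set {scalar X} := [set f | continuous f].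

(** K' *)
Definition dual_cone (K : set X) : set {scalar X} :=
  [set f | dual f /\ forall x, K x -> 0 <= f x].

(** Extended-real valued: the infimum is [+oo] when no [y] dominates both [0]
    and [x], and it may be [-oo] when [phi] is not positive. *)
Definition p_phi (K : set X) (phi : {scalar X}) (x : X) : \bar R :=
  ereal_inf [set (phi y)%:E | y in [set y | cone_le K 0 y /\ cone_le K x y]].

Definition subdiff (K : set X) (p : X -> \bar R) (x : X) : set {scalar X} :=
  [set f | [/\ dual_cone K f,
              forall y, ((f y)%:E <= p y)%E &
              (f x)%:E = p x] ].

(** Linear operator with a domain. The domain is a linear subspace; the values
    of [op_fun] outside [op_dom] are arbitrary and never used. *)
Record operator := Operator {
  op_dom : set X;
  op_fun :> X -> X;
  op_dom_submod : op_dom 0 /\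
    forall (a : R) (x y : X), op_dom x -> op_dom y -> op_dom (a *: x + y);
  op_fun_linear : forall (a : R) (x y : X), op_dom x -> op_dom y ->
    op_fun (a *: x + y) = a *: op_fun x + op_fun y }.

Definition p_dissipative (K : set X) (p : X -> \bar R) (A : operator) : Prop :=
  forall x, op_dom A x -> exists2 f, subdiff K p x f & f (A x) <= 0.

Definition bounded_map (T : X -> X) : Prop :=
  exists M : R, forall x, `|T x| <= M * `|x|.

Definition p_contractive (p : X -> \bar R) (T : X -> X) : Prop :=
  [/\ linear T, bounded_map T & forall x, (p (T x) <= p x)%E].

(** [I - lambda A], with domain [op_dom A]. *)
Definition id_sub (lambda : R) (A : operator) (x : X) : X :=
  x - lambda *: A x.

(** The default value in ['pinv_] is irrelevant once [id_sub lambda A] maps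
    [op_dom A] onto [X]. *)
Definition resolvent (lambda : R) (A : operator) : X -> X :=
  'pinv_(fun=> 0) (op_dom A) (id_sub lambda A).

Definition id_sub_invertible (lambda : R) (A : operator) : Prop :=
  set_bij (op_dom A) setT (id_sub lambda A) /\
  bounded_map (resolvent lambda A).

End OrderedBanach.

Arguments operator {R} X.

(* Main.v *)
Require Import Defs.
From HB Require Import structures.
From mathcomp Require Import all_boot all_order all_algebra.
From mathcomp Require Import all_classical all_reals all_analysis.

Set Implicit Arguments.
Unset Strict Implicit.
Unset Printing Implicit Defensive.

Import Order.TTheory GRing.Theory Num.Theory.
Import numFieldNormedType.Exports.

Local Open Scope classical_set_scope.
Local Open Scope ring_scope.

(** If [u = (I - lambda A)^-1 x] and [f] is the functional that dissipativity
    provides at [u], then applying [f] to [u = x + lambda A u] gives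
    [p u = f u = f x + lambda f (A u) <= f x <= p x].  The functional must be
    taken at [u], where [f] attains [p]; at [x] the bound [f x <= p x] is
    enough; [dissipative_le_id_sub] is this computation for a general
    extended-real function [p].  The resolvent is linear because [id_sub] is
    linear and injective on a domain that is a subspace: both sides of the
    linearity equation lie in the domain and have the same image. *)

Section Resolvent.
Context {R : realType} {X : completeNormedModType R}.
Implicit Types (A : operator X) (lambda a : R) (K : set X) (p : X -> \bar R).

Lemma id_sub_linear lambda A a (x y : X) : op_dom A x -> op_dom A y ->
  id_sub lambda A (a *: x + y) = a *: id_sub lambda A x + id_sub lambda A y.
Proof.
move=> Ax Ay; rewrite /id_sub op_fun_linear // !scalerDr opprD scalerN.
by rewrite !scalerA (mulrC a) addrACA.
Qed.

Lemma dissipative_le_id_sub K p A lambda (u : X) :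
  p_dissipative K p A -> 0 <= lambda -> op_dom A u ->
  (p u <= p (id_sub lambda A u))%E.
Proof.
move=> dissA lambda_ge0 Au; have [f [_ f_le_p <-] fAu_le0] := dissA u Au.
apply: le_trans (f_le_p _).
rewrite lee_fin /id_sub linearB linearZ /= lerBrDr gerDl.
exact: mulr_ge0_le0.
Qed.

Lemma resolvent_dom lambda A (x : X) :
  id_sub_invertible lambda A -> op_dom A (resolvent lambda A x).
Proof.
case=> -[_ _ surj] _.
by apply: (surjpinv_image_sub (dflt := fun=> 0) surj); exists x.
Qed.

Lemma resolventK lambda A (x : X) :
  id_sub_invertible lambda A -> id_sub lambda A (resolvent lambda A x) = x.
Proof. by case=> -[_ _ surj] _; apply: (surjpK _ surj); rewrite inE. Qed.

Lemma resolvent_linear lambda A :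
  id_sub_invertible lambda A -> linear (resolvent lambda A).
Proof.
move=> invA a x y; have [[_ inj _] _] := invA.
have [_ domD] := op_dom_submod A.
apply: inj; rewrite ?inE.
- exact: resolvent_dom.
- by apply: domD; exact: resolvent_dom.
- by rewrite id_sub_linear ?resolventK //; exact: resolvent_dom.
Qed.

End Resolvent.

Theorem theorem4p1 (R : realType) (X : completeNormedModType R) (K : set X)
    (hK : cone K) (phi : {scalar X}) (hphi : dual phi) (A : operator X)
    (hA : p_dissipative K (p_phi K phi) A) (lambda : R) (hlambda : 0 < lambda)
    (hinv : id_sub_invertible lambda A) :
  p_contractive (p_phi K phi) (resolvent lambda A).
Proof.
split; first exact: resolvent_linear.
  by case: hinv.
move=> x; rewrite -[leRHS](congr1 (p_phi K phi) (resolventK x hinv)).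
by apply: dissipative_le_id_sub hA (ltW hlambda) (resolvent_dom x hinv).
Qed.
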